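(* Let $\mathcal{H}$ be a hypergraph on a finite vertex set $V$, let $p\in[0,1]$, $\alpha\in(0,1]$ and $\eta\in(0,1]$. Writing $\mu=\mu_p(\mathcal{H})$ and $\Delta=\Delta_p(\mathcal{H})$, \[ \Pr\big(\nu(\mathcal{H}[V_p])\le \alpha\mu\big)\le \exp\Big(-\big(1-\alpha\log(e/\alpha)-\alpha p-\eta\big)\mu+\big(1+2\alpha p/\eta\big)\Delta\Big). \]
   Context: $V_p$ denotes the random subset of $V$ containing each element independently with probability $p$. For $W\subseteq V$, $\mathcal{H}[W]=\{A\in\mathcal{H}: A\subseteq W\}$. $\nu(\cdot)$ is the matching number (largest number of pairwise disjoint edges). $\mu_p(\mathcal{H})=\sum_{A\in\mathcal{H}}p^{|A|}$ and $\Delta_p(\mathcal{H})=\sum p^{|A\cup B|}$, the sum over unordered pairs $\{A,B\}$ of distinct edges of $\mathcal{H}$ with $A\cap B\neq\emptyset$. *)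

(* Defs.v *)
From HB Require Import structures.
From mathcomp Require Import all_boot all_order all_algebra.
From mathcomp Require Import reals sequences exp.
Set Implicit Arguments. Unset Strict Implicit. Unset Printing Implicit Defensive.
Import Order.TTheory GRing.Theory Num.Theory.
Local Open Scope ring_scope.

(* A hypergraph on the finite vertex set V = [set: T] is H : {set {set T}}. *)

Definition induced (T : finType) (H : {set {set T}}) (W : {set T}) : {set {set T}} :=
  [set A in H | A \subset W].

Definition is_matching (T : finType) (H M : {set {set T}}) : bool :=
  (M \subset H) &&
  [forall A in M, forall B in M, (A != B) ==> [disjoint A & B]].

Definition nu (T : finType) (H : {set {set T}}) : nat :=
  \max_(M : {set {set T}} | is_matching H M) #|M|.

Definition mu_p (R : realType) (T : finType) (p : R) (H : {set {set T}}) : R :=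
  \sum_(A in H) p ^+ #|A|.

(* Delta_p(H) = sum over unordered pairs {A,B} of distinct edges with
   A ∩ B <> ∅ of p^|A ∪ B|; an unordered pair is a 2-element subset S of H. *)
Definition Delta_p (R : realType) (T : finType) (p : R) (H : {set {set T}}) : R :=
  \sum_(S : {set {set T}} | (S \subset H) && (#|S| == 2%N)
                            && (\bigcap_(A in S) A != set0))
     p ^+ #|\bigcup_(A in S) A|.

(* Pr(V_p = W) where V_p contains each vertex independently with prob. p *)
Definition binom_weight (R : realType) (T : finType) (p : R) (W : {set T}) : R :=
  p ^+ #|W| * (1 - p) ^+ (#|T| - #|W|).

Definition prob_Vp (R : realType) (T : finType) (p : R) (E : pred {set T}) : R :=
  \sum_(W : {set T} | E W) binom_weight p W.

(* Main.v *)
(** If the matching number of the random subhypergraph is at most s, then it has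
    a maximal matching M with at most s edges: M is present while no edge off the
    vertex set of M is. By Janson's inequality this has probability at most
    [exp (- mu + Delta) * \prod_(A in M) (p^|A| * exp d(A))], where [d(A)] is the
    weight of the edges meeting A. Charging a factor [alpha^(|M| - s) >= 1] to M,
    the sum over all M is bounded by the product of [1 + alpha p^|A|].
    The degrees [d(A)] have weighted average about [p + 2 p Delta / mu]; by Markov,
    dropping edges of total weight at most [eta mu] makes them all at most
    [p + 2 p Delta / (eta mu)]. *)

Require Import Defs.
From HB Require Import structures.
From mathcomp Require Import all_boot all_order all_algebra.
From mathcomp Require Import reals sequences exp.
From mathcomp Require Import ring lra.
Import Order.TTheory GRing.Theory Num.Theory.
Local Open Scope ring_scope.

Set Implicit Arguments.
Unset Strict Implicit.
Unset Printing Implicit Defensive.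

(** * Events of the random vertex set *)

Lemma prod_expr_card (R : realType) (T : finType) (W : {set T}) (a b : R) :
  \prod_(i : T) (if i \in W then a else b) = a ^+ #|W| * b ^+ (#|T| - #|W|).
Proof.
rewrite (bigID (mem W)) /=.
rewrite (eq_bigr (fun=> a)); last by move=> i ->.
rewrite (eq_bigr (fun=> b) (P := fun i => i \notin W)); last by move=> i /negbTE ->.
rewrite !prodr_const; congr (_ * _ ^+ _).
by rewrite -(cardC (mem W)) addKn; apply: eq_card.
Qed.

Section Vp.
Variables (R : realType) (T : finType) (p : R).
Hypotheses (hp0 : 0 <= p) (hp1 : p <= 1).
Implicit Types (W U : {set T}) (E F D : pred {set T}) (v : T).

Lemma binom_weight_ge0 W : 0 <= binom_weight p W.
Proof. by rewrite mulr_ge0 ?exprn_ge0 // subr_ge0. Qed.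

Lemma sum_binom_weight : \sum_(W : {set T}) binom_weight p W = 1.
Proof.
under eq_bigr do rewrite /binom_weight -prod_expr_card.
by rewrite -bigA_distr big1 // => i _; rewrite [LHS]addrC subrK.
Qed.

Lemma prob_le_sub E F : (forall W, E W -> F W) -> prob_Vp p E <= prob_Vp p F.
Proof.
move=> sEF; rewrite /prob_Vp [leRHS](bigID E) /=.
rewrite (eq_bigl E) => [|W]; last by apply: andb_idl; apply: sEF.
by rewrite lerDl sumr_ge0 // => W _; apply: binom_weight_ge0.
Qed.

Lemma prob_split F E :
  prob_Vp p E = prob_Vp p (fun W => F W && E W) + prob_Vp p (fun W => ~~ F W && E W).
Proof.
by rewrite /prob_Vp (bigID F); congr (_ + _); apply: eq_bigl => W; rewrite andbC.
Qed.

Lemma prob_ge0 E : 0 <= prob_Vp p E.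
Proof. by apply: sumr_ge0 => W _; apply: binom_weight_ge0. Qed.

Lemma prob_true : prob_Vp p (xpredT : pred {set T}) = 1.
Proof. exact: sum_binom_weight. Qed.

Lemma prob_le1 E : prob_Vp p E <= 1.
Proof. by rewrite -prob_true; apply: prob_le_sub. Qed.

Lemma prob_union (I : finType) (P : pred I) (F : I -> pred {set T}) E :
  (forall W, E W -> exists2 i, P i & F i W) ->
  prob_Vp p E <= \sum_(i | P i) prob_Vp p (F i).
Proof.
move=> EF; rewrite /prob_Vp.
under [leRHS]eq_bigr do rewrite big_mkcond /=.
rewrite exchange_big /= [leLHS]big_mkcond /=; apply: ler_sum => W _.
have pos i : 0 <= (if F i W then binom_weight p W else 0).
  by case: ifP => // _; apply: binom_weight_ge0.
case: ifP => [EW|_]; last by apply: sumr_ge0.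
have [i Pi FiW] := EF W EW.
by rewrite (bigD1 i) //= FiW lerDl sumr_ge0.
Qed.

Lemma binom_weight_setU1 v W : v \notin W ->
  (1 - p) * binom_weight p (v |: W) = p * binom_weight p W.
Proof.
move=> vW; have ltW : (#|W| < #|T|)%N.
  by rewrite -[#|T|]cardsT proper_card // properEneq subsetT andbT;
     apply: contra vW => /eqP ->; rewrite inE.
by rewrite /binom_weight cardsU1 vW add1n exprS -(subnSK ltW) exprS; ring.
Qed.

(** Sets avoiding [v] are paired with the sets obtained by adding [v]. The ratio [p / (1 - p)] is
    cross-multiplied so that [p = 1] is covered. *)
Lemma prob_mem_shift v E :
  (1 - p) * prob_Vp p (fun W => (v \in W) && E W)
  = p * prob_Vp p (fun W => (v \notin W) && E (v |: W)).
Proof.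
rewrite /prob_Vp !big_distrr /=.
rewrite (reindex_onto (fun W => v |: W) (fun W => W :\ v)) /=; last first.
  by move=> W /andP[vW _]; rewrite setD1K.
apply: eq_big => [W|W /andP[_ /eqP <-]]; last first.
  by rewrite binom_weight_setU1 // !inE eqxx.
rewrite setU11 /= andbC; congr (_ && _).
have [vW|vW] := boolP (v \in W); last by rewrite setU1K ?eqxx.
by apply/eqP => /setP /(_ v); rewrite !inE eqxx vW.
Qed.

(** One-vertex case of Harris' inequality. By the shift identity, the left side is [p] times the sum
    of itself and the probability that [v] is absent while [E] holds after adding [v]; by hypothesis
    [E] then held before. *)
Lemma prob_mem_le v E : (forall W, v \notin W -> E (v |: W) -> E W) ->
  prob_Vp p (fun W => (v \in W) && E W) <= p * prob_Vp p E.
Proof.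
move=> dE; have := prob_mem_shift v E; rewrite (prob_split (fun W => v \in W) E).
have : prob_Vp p (fun W => (v \notin W) && E (v |: W))
    <= prob_Vp p (fun W => (v \notin W) && E W).
  by apply: prob_le_sub => W /andP[vW EW]; rewrite vW dE.
by move=> /(ler_wpM2l hp0); lra.
Qed.

Lemma prob_mem_ge v E : (forall W, v \notin W -> E W -> E (v |: W)) ->
  p * prob_Vp p E <= prob_Vp p (fun W => (v \in W) && E W).
Proof.
move=> dE; have := prob_mem_shift v E; rewrite (prob_split (fun W => v \in W) E).
have : prob_Vp p (fun W => (v \notin W) && E W)
    <= prob_Vp p (fun W => (v \notin W) && E (v |: W)).
  by apply: prob_le_sub => W /andP[vW EW]; rewrite vW dE.
by move=> /(ler_wpM2l hp0); lra.
Qed.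

Lemma prob_eq E F : E =1 F -> prob_Vp p E = prob_Vp p F.
Proof. exact: eq_bigl. Qed.

(** The vertices of [U] are peeled off one at a time; [D] has to be decreasing only in these
    vertices. *)
Lemma prob_sub_le U D :
  (forall v W, v \in U -> v \notin W -> D (v |: W) -> D W) ->
  prob_Vp p (fun W => (U \subset W) && D W) <= p ^+ #|U| * prob_Vp p D.
Proof.
elim: {U}_.+1 {-2}U (ltnSn #|U|) => // n IHn U leU dD.
have [->|[v vU]] := set_0Vmem U.
  by rewrite cards0 mul1r; apply: prob_le_sub => W /andP[].
rewrite (cardsD1 v) vU add1n exprS -mulrA.
rewrite (prob_eq (F := fun W => (v \in W) && ((U :\ v \subset W) && D W))); last first.
  by move=> W; rewrite -{1}(setD1K vU) subUset sub1set andbA.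
apply: le_trans (prob_mem_le _) _.
  move=> W vW /andP[UW /(dD _ _ vU vW) ->]; rewrite andbT.
  apply/subsetP => x xU; have /setU1P[xv|//] := subsetP UW x xU.
  by rewrite xv !inE eqxx in xU.
rewrite ler_wpM2l // IHn //; first by move: leU; rewrite (cardsD1 v) vU.
by move=> x W /setD1P[_ xU]; apply: dD.
Qed.

(** Counterpart for events increasing along [U]. It covers in particular events that ignore [U],
    which is how independence enters Janson's inequality. *)
Lemma prob_sub_ge U D :
  (forall v W, v \in U -> v \notin W -> D W -> D (v |: W)) ->
  p ^+ #|U| * prob_Vp p D <= prob_Vp p (fun W => (U \subset W) && D W).
Proof.
elim: {U}_.+1 {-2}U (ltnSn #|U|) => // n IHn U leU dD.
have [->|[v vU]] := set_0Vmem U.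
  by rewrite cards0 mul1r; apply: prob_le_sub => W ->; rewrite sub0set.
rewrite (cardsD1 v) vU add1n exprS -mulrA.
rewrite (prob_eq (E := fun W => (U \subset W) && D W)
  (F := fun W => (v \in W) && ((U :\ v \subset W) && D W))); last first.
  by move=> W; rewrite -{1}(setD1K vU) subUset sub1set andbA.
apply: le_trans (prob_mem_ge _); last first.
  move=> W vW /andP[UW /(dD _ _ vU vW) ->]; rewrite andbT.
  exact: subset_trans UW (subsetUr _ _).
rewrite ler_wpM2l // IHn //; first by move: leU; rewrite (cardsD1 v) vU.
by move=> x W /setD1P[_ xU]; apply: dD.
Qed.

(** * Behaviour of [mu_p] and [Delta_p] when edges are added *)

Implicit Types (H K M : {set {set T}}) (A B : {set T}).

Lemma mu_setU1 A K : A \notin K -> mu_p p (A |: K) = p ^+ #|A| + mu_p p K.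
Proof. exact: big_setU1. Qed.

Lemma mu_ge0 H : 0 <= mu_p p H.
Proof. by apply: sumr_ge0 => A _; rewrite exprn_ge0. Qed.

Lemma Delta_ge0 H : 0 <= Delta_p p H.
Proof. by apply: sumr_ge0 => A _; rewrite exprn_ge0. Qed.

Lemma Delta_mono K H : K \subset H -> Delta_p p K <= Delta_p p H.
Proof.
move=> sKH; rewrite /Delta_p [leLHS]big_mkcond [leRHS]big_mkcond /=.
apply: ler_sum => S _; have [SK|_] := boolP (S \subset K).
  by rewrite (subset_trans SK sKH).
by case: ifP => // _; rewrite exprn_ge0.
Qed.

(** The intersecting pairs are split by whether they contain [A]; those that do are the images of
    the neighbours [B] under the injection [B] to [[set A; B]]. *)
Lemma Delta_setU1 A K : A \notin K ->
  Delta_p p K + \sum_(B in K | ~~ [disjoint A & B]) p ^+ #|A :|: B|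
    <= Delta_p p (A |: K).
Proof.
move=> AK; rewrite /Delta_p [leRHS](bigID (fun S : {set {set T}} => A \notin S)) /=.
apply: lerD.
  rewrite [leLHS]big_mkcond [leRHS]big_mkcond /=; apply: ler_sum => S _.
  have [SK|_] := boolP (S \subset K); last by case: ifP => // _; rewrite exprn_ge0.
  rewrite (subset_trans SK (subsetUr _ _)) /= (contra (subsetP SK A) AK).
  by rewrite andbT.
have injA : {in [pred B in K | ~~ [disjoint A & B]] &, injective (fun B => [set A; B])}.
  move=> B C /andP[BK _] /andP[CK _] /setP /(_ B); rewrite !inE eqxx orbT.
  by case/esym/orP => /eqP // eBA; rewrite -eBA BK in AK.
rewrite (eq_bigr (fun B => p ^+ #|\bigcup_(C in [set A; B]) C|)); last first.
  by move=> B /andP[BK _]; rewrite bigcup_setU !big_set1.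
rewrite -(big_imset (fun S : {set {set T}} => p ^+ #|\bigcup_(C in S) C|) injA) /=.
rewrite [leLHS]big_mkcond [leRHS]big_mkcond /=; apply: ler_sum => S _.
case: ifP => [/imsetP[B /andP[BK ndAB] ->]|_]; last by case: ifP => // _; rewrite exprn_ge0.
have nAB : A != B by apply: contraNneq AK => ->.
rewrite subUset !sub1set !inE eqxx BK orbT cards2 nAB /=.
have -> // : \bigcap_(C in [set A; B]) C != set0.
by rewrite bigcap_setU !big_set1 setI_eq0.
Qed.

(** * Janson's inequality *)

Definition no_edge K : pred {set T} := fun W => [forall A in K, ~~ (A \subset W)].

Lemma no_edge_sub K W W' : W \subset W' -> no_edge K W' -> no_edge K W.
Proof.
move=> sW /forall_inP nK; apply/forall_inP => A /nK.
by apply: contra => /subset_trans; apply.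
Qed.

(* Boppana and Spencer's argument, with a one-sided form of Harris' inequality
   ([prob_sub_le]) in place of conditional probabilities. *)
Theorem janson K : prob_Vp p (no_edge K) <= expR (- mu_p p K + Delta_p p K).
Proof.
elim: {K}_.+1 {-2}K (ltnSn #|K|) => // n IHn K leK.
have [->|[A AK]] := set_0Vmem K.
  by apply: le_trans (prob_le1 _) _; rewrite /mu_p big_set0 oppr0 add0r -expR0 ler_expR Delta_ge0.
move: leK; rewrite (cardsD1 A) AK add1n ltnS => leK.
have AK' : A \notin K :\ A by rewrite !inE eqxx.
rewrite -(setD1K AK); move: (K :\ A) AK' leK => {AK}K AK leK.
rewrite (mu_setU1 AK).
set d := \sum_(B in K | ~~ [disjoint A & B]) p ^+ #|A :|: B|.
have dle : Delta_p p K + d <= Delta_p p (A |: K) by apply: Delta_setU1.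
(* One new edge should cost a factor [1 - p ^+ #|A| + d], at most the exponential shown; [d] is paid
   for by the growth of [Delta_p]. *)
suff step : prob_Vp p (no_edge (A |: K)) <= expR (- p ^+ #|A| + d) * prob_Vp p (no_edge K).
  apply: le_trans step _; apply: le_trans (ler_wpM2l (expR_ge0 _) (IHn K leK)) _.
  by rewrite -expRD ler_expR; lra.
apply: le_trans (ler_wpM2r (prob_ge0 _) (expR_ge1Dx _)).
have := prob_split (fun W => A \subset W) (no_edge K).
rewrite (prob_eq (E := fun W => ~~ (A \subset W) && no_edge K W) (F := no_edge (A |: K))); last first.
  move=> W; apply/andP/forall_inP => [[nA /forall_inP nK] B /setU1P[->|]|nK] //; first exact: nK.
  by split; [apply: nK; rewrite setU11|apply/forall_inP => B BK; apply: nK; rewrite setU1r].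
(* Only the edges of K disjoint from A are independent of the event [A \subset W]. *)
pose K1 := [set B in K | [disjoint A & B]].
have indep : p ^+ #|A| * prob_Vp p (no_edge K1)
    <= prob_Vp p (fun W => (A \subset W) && no_edge K1 W).
  apply: prob_sub_ge => v W vA vW /forall_inP nK1; apply/forall_inP => B BK1.
  apply: contra (nK1 B BK1) => sB; apply/subsetP => x xB.
  have /setU1P[xv|//] := subsetP sB x xB.
  by move: BK1; rewrite inE => /andP[_ /disjointFr /(_ vA)]; rewrite -xv xB.
(* If some edge of [K] is present but none of [K1], that edge [B] meets [A]. For each such [B],
   containing [A :|: B] is negatively correlated with the decreasing event [no_edge K1]. *)
have split1 : prob_Vp p (fun W => (A \subset W) && no_edge K1 W)
    <= prob_Vp p (fun W => (A \subset W) && no_edge K W) + d * prob_Vp p (no_edge K1).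
  rewrite (prob_split (no_edge K)); apply: lerD.
    by apply: prob_le_sub => W /and3P[-> -> _].
  rewrite /d mulr_suml.
  apply: le_trans (prob_union (P := fun B => (B \in K) && ~~ [disjoint A & B])
     (F := fun B W => (A :|: B \subset W) && no_edge K1 W) _) _.
    move=> W /and3P[/forall_inPn[B BK /negPn BW] AW nK1]; exists B.
      rewrite BK /=; apply/negP => dAB; have /forall_inP /(_ B) := nK1.
      by rewrite inE BK dAB BW => /(_ isT).
    by rewrite subUset AW BW.
  apply: ler_sum => B _; apply: prob_sub_le => v W _ _.
  exact: no_edge_sub (subsetUr _ _).
have K1K : prob_Vp p (no_edge K) <= prob_Vp p (no_edge K1).
  apply: prob_le_sub => W /forall_inP nK; apply/forall_inP => B.
  by rewrite inE => /andP[/nK].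
(* Replacing [K1] by [K] in the lower bound requires a nonnegative factor [p ^+ #|A| - d]; otherwise
   the bound is trivial. *)
have [neg|pos] := lerP (p ^+ #|A| - d) 0.
  have := prob_ge0 (fun W => (A \subset W) && no_edge K W).
  have := mulr_ge0 (prob_ge0 (no_edge K)) (_ : 0 <= d - p ^+ #|A|).
  by rewrite subr_ge0 -subr_le0 => /(_ neg); lra.
have := ler_wpM2l (ltW pos) K1K; lra.
Qed.

(** * Weighted degrees and their total *)

Definition weighted_degree H A : R :=
  \sum_(B in H | (B != A) && ~~ [disjoint A & B]) p ^+ #|B|.

(** The exponents differ by [#|A :&: B|], which is at least 1. This gain is the source of the factor
    [p] in front of [Delta] in the final error term. *)
Lemma expr_meet A B : ~~ [disjoint A & B] ->
  p ^+ #|A| * p ^+ #|B| <= p * p ^+ #|A :|: B|.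
Proof.
rewrite -setI_eq0 -card_gt0 => ABgt0.
rewrite -exprD -cardsUI addnC exprD ler_wpM2r ?exprn_ge0 //.
by rewrite -[leRHS]expr1 ler_wiXn2l.
Qed.

Lemma weighted_degree_setU1 A C K : A \notin K -> C \in K ->
  weighted_degree (A |: K) C =
  (if ~~ [disjoint A & C] then p ^+ #|A| else 0) + weighted_degree K C.
Proof.
move=> AK CK; rewrite /weighted_degree !big_mkcondr /= big_setU1 //=.
have -> : A != C by apply: contraNneq AK => ->.
by rewrite disjoint_sym.
Qed.

Lemma weighted_degree_setU1_self A K : A \notin K ->
  weighted_degree (A |: K) A = \sum_(C in K | ~~ [disjoint A & C]) p ^+ #|C|.
Proof.
move=> AK; rewrite /weighted_degree !big_mkcondr /= big_setU1 //= eqxx add0r.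
apply: eq_bigr => C CK; have -> // : C != A by apply: contraNneq AK => <-.
Qed.

(** Each intersecting pair is counted once from either end, and each time [expr_meet] gains a factor
    [p]. *)
Lemma sum_weighted_degree H :
  \sum_(A in H) p ^+ #|A| * weighted_degree H A <= 2 * p * Delta_p p H.
Proof.
elim: {H}_.+1 {-2}H (ltnSn #|H|) => // n IHn H leH.
have [->|[A AH]] := set_0Vmem H.
  by rewrite big_set0 !mulr_ge0 // Delta_ge0.
move: leH; rewrite (cardsD1 A) AH add1n ltnS => leK.
have AK : A \notin H :\ A by rewrite !inE eqxx.
rewrite -(setD1K AH); move: (H :\ A) AK leK => {AH}K AK leK.
rewrite big_setU1 //= weighted_degree_setU1_self //.
rewrite [X in _ + X <= _](eq_bigr (fun C : {set T} => p ^+ #|C| * (if ~~ [disjoint A & C] then p ^+ #|A| else 0)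
   + p ^+ #|C| * weighted_degree K C)); last first.
  by move=> C CK; rewrite weighted_degree_setU1 // mulrDr.
rewrite big_split /=.
(* [s1] is the degree of the new edge [A]; [s2] is the weighted increase that [A] causes in the
   other degrees. They give the two halves of the factor 2. *)
set s1 := \sum_(C in K | _) _; set s2 := \sum_(C in K) _ * (if _ then _ else _).
set d := \sum_(B in K | ~~ [disjoint A & B]) p ^+ #|A :|: B|.
have dle : Delta_p p K + d <= Delta_p p (A |: K) by apply: Delta_setU1.
have s1d : p ^+ #|A| * s1 <= p * d.
  rewrite /s1 /d !mulr_sumr; apply: ler_sum => B /andP[_]; exact: expr_meet.
have s2E : s2 = p ^+ #|A| * s1.
  rewrite /s2 /s1 mulr_sumr [RHS]big_mkcondr /=; apply: eq_bigr => C _.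
  by case: ifP => _; rewrite ?mulr0 // mulrC.
have := IHn _ leK; have := ler_wpM2l hp0 dle; rewrite s2E; lra.
Qed.

(** * Sums over subsets, matchings and the matching number *)

Lemma sum_subset_prod (I : finType) (X : {set I}) (x : I -> R) :
  (forall i, i \in X -> 0 <= x i) ->
  \sum_(J : {set I} | J \subset X) \prod_(i in J) x i <= expR (\sum_(i in X) x i).
Proof.
(* Extending [x] by zero off [X] makes the sum part of the full expansion of the product of the
   [y i + 1], whose factors are at most [expR (y i)]. *)
move=> x0; pose y i := if i \in X then x i else 0.
have y0 i : 0 <= y i by rewrite /y; case: ifP => // /x0.
apply: (@le_trans _ _ (\prod_i (y i + 1))); last first.
  rewrite [X in expR X]big_mkcond expR_sum; apply: ler_prod => i _.
  by rewrite addr_ge0 //= addrC expR_ge1Dx.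
rewrite bigA_distr big_mkcond /=; apply: ler_sum => J _.
case: ifP => [JX|_]; last by apply: prodr_ge0 => i _; case: ifP.
rewrite big_mkcond /=; apply: ler_prod => i _; case: ifP => iJ; last by rewrite ler01 lexx.
by rewrite /y (subsetP JX) // x0 ?lexx ?(subsetP JX).
Qed.

Lemma matching_trivIset H M : is_matching H M -> trivIset M.
Proof.
case/andP=> _ /forall_inP mM; apply/trivIsetP => A B AM BM nAB.
by have /forall_inP /(_ B BM) := mM A AM; rewrite nAB.
Qed.

Lemma is_matchingP H M :
  reflect (M \subset H /\ {in M &, forall A B, A != B -> [disjoint A & B]})
          (is_matching H M).
Proof.
apply: (iffP andP) => -[sMH mM]; split=> //.
  move=> A B AM BM nAB.
  by move/forall_inP: mM => /(_ A AM) /forall_inP /(_ B BM); rewrite nAB.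
by apply/forall_inP => A AM; apply/forall_inP => B BM; apply/implyP; apply: mM.
Qed.

Lemma leq_nu H M : is_matching H M -> (#|M| <= nu H)%N.
Proof. exact: leq_bigmax_cond. Qed.

Lemma nu_attained H : exists2 M, is_matching H M & #|M| = nu H.
Proof.
have m0 : is_matching H set0.
  by apply/is_matchingP; split=> [|A B]; rewrite ?sub0set ?inE.
have card0 : (0 < #|is_matching H|)%N by apply/card_gt0P; exists set0.
by have [M mM nuM] := eq_bigmax_cond (fun M : {set {set T}} => #|M|) card0; exists M.
Qed.

Lemma matching_setU1 H A M : is_matching H M -> A \in H ->
  (forall B, B \in M -> [disjoint A & B]) -> is_matching H (A |: M).
Proof.
move=> /is_matchingP[sMH mM] AH dA; apply/is_matchingP; split.
  by rewrite subUset sub1set AH.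
move=> B C /setU1P[->|BM] /setU1P[->|CM]; rewrite ?eqxx //.
- by move=> _; apply: dA.
- by move=> _; rewrite disjoint_sym; apply: dA.
- exact: mM.
Qed.

Lemma matching_mono H K M : K \subset H -> is_matching K M -> is_matching H M.
Proof. by move=> sKH /andP[sMK mM]; rewrite /is_matching (subset_trans sMK). Qed.

Lemma nu_mono H K : K \subset H -> (nu K <= nu H)%N.
Proof. by move=> sKH; have [M /(matching_mono sKH) /leq_nu + <-] := nu_attained K. Qed.

(** The empty edge is disjoint from every edge, so it extends any matching of the others. *)
Lemma nu_set0 H : set0 \in H -> (nu (H :\ set0) < nu H)%N.
Proof.
move=> H0; have [M mM <-] := nu_attained (H :\ set0).
have : is_matching H (set0 |: M).
  apply: matching_setU1 => //; first exact: matching_mono (subsetDl _ _) mM.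
  by move=> B _; rewrite -setI_eq0 set0I.
move/leq_nu; rewrite cardsU1; have -> // : set0 \notin M.
by have /is_matchingP[/subsetP sM _] := mM; apply/negP => /sM; rewrite !inE eqxx.
Qed.

(** * Union bound over maximal matchings *)

Definition edges_off H M := [set B in H | [disjoint cover M & B]].

Lemma maximal_matching H W : set0 \notin H ->
  exists2 M, is_matching H M /\ (#|M| = nu (induced H W)) &
    (cover M \subset W) && no_edge (edges_off H M) W.
Proof.
move=> H0; have [M mM nuM] := nu_attained (induced H W).
have sIH : induced H W \subset H by apply/subsetP => A; rewrite inE => /andP[].
have /is_matchingP[/subsetP sM _] := mM.
exists M; first by split; [exact: matching_mono mM|].
apply/andP; split.
  by apply/bigcupsP => A /sM; rewrite inE => /andP[].
apply/forall_inP => A; rewrite inE => /andP[AH dA]; apply/negP => AW.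
have : is_matching (induced H W) (A |: M).
  apply: matching_setU1 => //; first by rewrite inE AH.
  by move=> B BM; rewrite disjoint_sym; apply: disjointWl dA; apply: bigcup_sup.
move/leq_nu; rewrite -nuM cardsU1.
suff -> : A \notin M by rewrite add1n ltnn.
(* A member of [M] disjoint from [cover M] is disjoint from itself, hence empty. *)
apply: contra H0 => AM; move: dA; rewrite disjoint_sym.
move/(disjointWr (bigcup_sup A AM)); rewrite -setI_eq0 setIid => /eqP <-.
exact: AH.
Qed.

(** Every lost edge meets some [A] in [M]. For each [A], the edge itself weighs at most [p], being
    nonempty, and the other edges meeting it at most [c]. *)
Lemma mu_edges_off H M c : M \subset H -> set0 \notin H ->
  (forall A, A \in H -> weighted_degree H A <= c) ->
  mu_p p H - (p + c) * #|M|%:R <= mu_p p (edges_off H M).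
Proof.
move=> sMH H0 degc; rewrite lerBlDr /mu_p (bigID (fun B => [disjoint cover M & B])) /=.
apply: lerD; first by rewrite le_eqVlt (eq_bigl (mem (edges_off H M))) ?eqxx // => B; rewrite !inE.
apply: (@le_trans _ _ (\sum_(A in M) (p + c))); last first.
  by rewrite sumr_const mulr_natr.
apply: (@le_trans _ _ (\sum_(A in M) \sum_(B in H | ~~ [disjoint A & B]) p ^+ #|B|)); last first.
  apply: ler_sum => A AM; have AH := subsetP sMH A AM.
  have A0 : A != set0 by apply: contraNneq H0 => <-.
  rewrite (bigD1 A) /=; last by rewrite AH -setI_eq0 setIid.
  apply: lerD; first by rewrite -[leRHS]expr1 ler_wiXn2l // card_gt0.
  apply: le_trans (degc A AH); rewrite le_eqVlt; apply/orP; left; apply/eqP.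
  by apply: eq_bigl => B; rewrite -andbA [(_ != _) && _]andbC.
under [leRHS]eq_bigr do rewrite big_mkcondr /=.
rewrite exchange_big /= [leLHS]big_mkcondr /=; apply: ler_sum => B BH.
have pos A : 0 <= (if ~~ [disjoint A & B] then p ^+ #|B| else 0).
  by case: ifP => // _; rewrite exprn_ge0.
case: ifP => [|_]; last by apply: sumr_ge0.
case/pred0Pn => x /andP[/bigcupP[A AM xA] xB].
rewrite (bigD1 A) //=; have -> : ~~ [disjoint A & B].
  by apply/pred0Pn; exists x; rewrite /= xA.
by rewrite lerDl sumr_ge0.
Qed.

Lemma prob_nu_le_degree H (alpha s c : R) :
  set0 \notin H -> 0 < alpha -> alpha <= 1 -> 0 <= c ->
  (forall A, A \in H -> weighted_degree H A <= c) ->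
  prob_Vp p (fun W => (nu (induced H W))%:R <= s)
  <= expR (- mu_p p H + (p + c) * s - s * ln alpha + alpha * mu_p p H + Delta_p p H).
Proof.
move=> H0 a0 a1 c0 degc.
apply: le_trans (prob_union (P := fun M => is_matching H M && (#|M|%:R <= s))
  (F := fun M W => (cover M \subset W) && no_edge (edges_off H M) W) _) _.
  move=> W nuW; have [M [mM nuM] MW] := maximal_matching W H0.
  by exists M; rewrite // mM nuM.
(* [E] is the part independent of [M]; its term [- s * ln alpha] is the factor [alpha] to the power
   [- s]. The sum is then relaxed from small matchings to all subfamilies of [H]. *)
pose E := expR (- mu_p p H + (p + c) * s - s * ln alpha + Delta_p p H).
apply: (@le_trans _ _ (\sum_(M : {set {set T}} | M \subset H)
    E * \prod_(A in M) (alpha * p ^+ #|A|))); last first.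
  rewrite -mulr_sumr.
  apply: le_trans (ler_wpM2l (expR_ge0 _) (sum_subset_prod _)) _.
    by move=> A _; rewrite mulr_ge0 ?exprn_ge0 // ltW.
  rewrite -mulr_sumr -/(mu_p p H) -expRD ler_expR; lra.
have pos M : 0 <= E * \prod_(A in M) (alpha * p ^+ #|A|).
  by rewrite mulr_ge0 ?expR_ge0 // prodr_ge0 // => A _; rewrite mulr_ge0 ?exprn_ge0 // ltW.
rewrite [leLHS]big_mkcond [leRHS]big_mkcond /=; apply: ler_sum => M _.
case: ifP => [/andP[mM leMs]|_]; last by case: ifP.
have /is_matchingP[sMH _] := mM; rewrite sMH.
apply: le_trans (prob_sub_le _) _.
  by move=> v W _ _; apply: no_edge_sub (subsetUr _ _).
apply: le_trans (ler_wpM2l (exprn_ge0 _ hp0) (janson _)) _.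
(* The edges of a matching are disjoint, so the probability weight of [cover M] is the product of
   the edge weights. *)
rewrite big_split /= prodr_const -expr_sum (eqP (matching_trivIset mM)) mulrA mulrC.
rewrite ler_wpM2r ?exprn_ge0 //.
have -> : alpha ^+ #|M| = expR (#|M|%:R * ln alpha).
  by rewrite expRM_natl lnK // posrE.
rewrite /E -expRD ler_expR.
have := mu_edges_off sMH H0 degc.
have sO : edges_off H M \subset H by apply/subsetP => B; rewrite inE => /andP[].
have := Delta_mono sO.
have la : ln alpha <= 0 by rewrite ln_le0.
(* This replaces [#|M|] by the larger [s] in the exponent. *)
have : 0 <= (s - #|M|%:R) * (p + c - ln alpha).
  by rewrite mulr_ge0 ?subr_ge0 // (le_trans la) ?addr_ge0.
lra.
Qed.

(** * Removal of the edges of large degree *)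

Lemma prob_nu_le_nonempty H (alpha eta s : R) :
  set0 \notin H -> 0 < alpha -> alpha <= 1 -> 0 < eta ->
  prob_Vp p (fun W => (nu (induced H W))%:R <= s)
  <= expR (- (1 - eta) * mu_p p H + (p + 2 * p * Delta_p p H / (eta * mu_p p H)) * s
           - s * ln alpha + alpha * mu_p p H + Delta_p p H).
Proof.
move=> H0 a0 a1 e0; set c := 2 * p * Delta_p p H / (eta * mu_p p H).
have c0 : 0 <= c by rewrite divr_ge0 ?mulr_ge0 ?Delta_ge0 ?mu_ge0 // ltW.
pose H' := [set A in H | weighted_degree H A <= c].
have sH' : H' \subset H by apply/subsetP => A; rewrite inE => /andP[].
have degc A : A \in H' -> weighted_degree H' A <= c.
  rewrite inE => /andP[_ /(le_trans _)]; apply.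
  rewrite /weighted_degree [leLHS]big_mkcondl [leRHS]big_mkcondl /=.
  apply: ler_sum => B _; have [/(subsetP sH') -> //|_] := boolP (B \in H').
  by case: ifP => // _; rewrite exprn_ge0.
have muE : mu_p p H = mu_p p H' + \sum_(A in H | ~~ (weighted_degree H A <= c)) p ^+ #|A|.
  rewrite {1}/mu_p (bigID (fun A => weighted_degree H A <= c)); congr (_ + _).
  by apply: eq_bigl => A; rewrite inE.
have bad_ge0 : 0 <= \sum_(A in H | ~~ (weighted_degree H A <= c)) p ^+ #|A|.
  by apply: sumr_ge0 => A _; rewrite exprn_ge0.
have bad : \sum_(A in H | ~~ (weighted_degree H A <= c)) p ^+ #|A| <= eta * mu_p p H.
  have := mu_ge0 H; rewrite le_eqVlt => /predU1P[m0|m0].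
    by rewrite -m0 mulr0; have := mu_ge0 H'; lra.
  have sumd : \sum_(A in H | ~~ (weighted_degree H A <= c)) p ^+ #|A| * weighted_degree H A
      <= 2 * p * Delta_p p H.
    apply: le_trans (sum_weighted_degree H); rewrite [leRHS](bigID (fun A => ~~ (weighted_degree H A <= c))) /=.
    rewrite lerDl sumr_ge0 // => A _; rewrite mulr_ge0 ?exprn_ge0 // sumr_ge0 // => B _.
    by rewrite exprn_ge0.
  have cE : 2 * p * Delta_p p H = c * (eta * mu_p p H).
    by rewrite /c divfK // mulf_neq0 // gt_eqF.
  (* Markov's inequality divides by [c]. If [c = 0], the total of weight times degree vanishes, and
     edges of positive degree must have weight zero. *)
  have := c0; rewrite le_eqVlt => /predU1P[cz|cpos]; last first.
    rewrite -(ler_pM2l cpos) -cE; apply: le_trans sumd; rewrite mulr_sumr.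
    apply: ler_sum => A /andP[_]; rewrite -ltNge mulrC => /ltW dA.
    by rewrite ler_wpM2l ?exprn_ge0.
  rewrite big1 ?mulr_ge0 ?(ltW e0) ?mu_ge0 // => A PA.
  move: PA sumd; rewrite cE -cz mul0r => PA; rewrite (bigD1 A) //= => sumd.
  have rest : 0 <= \sum_(i in H | ~~ (weighted_degree H i <= 0) && (i != A)) p ^+ #|i| * weighted_degree H i.
    by apply: sumr_ge0 => B /and3P[_ + _]; rewrite -ltNge => /ltW ?; rewrite mulr_ge0 ?exprn_ge0.
  have /andP[_] := PA; rewrite -ltNge => dpos.
  apply/eqP; rewrite eq_le exprn_ge0 // andbT -(pmulr_lle0 _ dpos).
  move: sumd rest; under [X in _ + X <= _]eq_bigl do rewrite -andbA.
  lra.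
apply: le_trans (prob_le_sub (F := fun W => (nu (induced H' W))%:R <= s) _) _.
  move=> W; apply: le_trans; rewrite ler_nat; apply: nu_mono (_ : induced H' W \subset _).
  by apply/subsetP => A; rewrite !inE => /andP[/andP[-> _] ->].
have H'0 : set0 \notin H' by apply: contra H0; apply: (subsetP sH').
apply: le_trans (prob_nu_le_degree s H'0 a0 a1 c0 degc) _.
rewrite ler_expR; have := Delta_mono sH'.
have : alpha * mu_p p H' <= alpha * mu_p p H by rewrite ler_pM2l // muE lerDl.
lra.
Qed.

End Vp.

(** * The final bound, with and without the empty edge *)

Unset Implicit Arguments.

Theorem mainTheorem2 (R : realType) (T : finType) (H : {set {set T}})
  (p alpha eta : R)
  (hp0 : 0 <= p) (hp1 : p <= 1)
  (ha0 : 0 < alpha) (ha1 : alpha <= 1)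
  (he0 : 0 < eta) (he1 : eta <= 1) :
  let mu := mu_p p H in
  let Delta := Delta_p p H in
  prob_Vp p (fun W => (nu (induced H W))%:R <= alpha * mu)
  <= expR (- (1 - alpha * ln (expR 1 / alpha) - alpha * p - eta) * mu
           + (1 + 2 * alpha * p / eta) * Delta).
Proof.
cbv zeta; set mu := mu_p p H; set Delta := Delta_p p H.
have mu0 : 0 <= mu by apply: mu_ge0.
have D0 : 0 <= Delta by apply: Delta_ge0.
have lnE : ln (expR 1 / alpha) = 1 - ln alpha.
  by rewrite ln_div ?posrE ?expR_gt0 // expRK.
rewrite lnE.
(* With [s = alpha * m] the weight [m] cancels; for [m = 0] the left side is 0. *)
have xle (m D : R) : 0 <= m -> 0 <= D ->
    2 * p * D / (eta * m) * (alpha * m) <= 2 * alpha * p / eta * D.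
  move=> m0 d0; have [->|mn0] := eqVneq m 0.
    by rewrite !mulr0 mulr_ge0 // divr_ge0 ?mulr_ge0 // ltW.
  rewrite le_eqVlt; apply/orP; left; apply/eqP; field.
  by rewrite mn0 gt_eqF.
have [He|He] := boolP (set0 \in H); last first.
  apply: le_trans (prob_nu_le_nonempty hp0 hp1 (alpha * mu) He ha0 ha1 he0) _.
  rewrite ler_expR -/mu -/Delta; have := xle _ _ mu0 D0; lra.
(* The empty edge has weight 1 > p, so its degree is not bounded as above;
   but it lies in every maximal matching, whence s = alpha mu - 1 for H minus set0. *)
pose H0 := H :\ set0; pose m := mu_p p H0.
have H00 : set0 \notin H0 by rewrite !inE eqxx.
have muE : mu = 1 + m.
  by rewrite /mu -(setD1K He) mu_setU1 // cards0 expr0.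
have m0 : 0 <= m by apply: mu_ge0.
have DD : Delta_p p H0 <= Delta by apply: Delta_mono (subsetDl _ _).
have D00 : 0 <= Delta_p p H0 by apply: Delta_ge0.
apply: le_trans (prob_le_sub (F := fun W => (nu (induced H0 W))%:R <= alpha * mu - 1) hp0 hp1 _) _.
  move=> W leW; rewrite lerBrDr; apply: le_trans leW; rewrite natr1 ler_nat.
  suff -> : induced H0 W = induced H W :\ set0.
    by apply: nu_set0; rewrite inE He sub0set.
  by apply/setP => A; rewrite !inE andbA.
apply: le_trans (prob_nu_le_nonempty hp0 hp1 _ H00 ha0 ha1 he0) _.
rewrite ler_expR -/m muE.
have := xle _ _ m0 D00.
set c := 2 * p * _ / (eta * m) => cle.
have c0 : 0 <= c by rewrite divr_ge0 ?mulr_ge0 // ltW.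
(* Lowering [s] by 1 adds [ln alpha] to the exponent, which offsets the [1 - alpha] demanded by the
   extra unit of weight in [mu = 1 + m]. *)
have lna : ln alpha <= alpha - 1.
  by have := @le_ln1Dx _ (alpha - 1); rewrite [1 + _]addrC subrK; apply; lra.
have a1 : alpha <= 1 := ha1.
(* The unit subtracted from [s] also absorbs the surplus [c * alpha] due to the empty edge, as
   [alpha <= 1]. *)
have h1 : (p + c) * (alpha * (1 + m) - 1) <= p * (alpha * (1 + m)) + c * (alpha * m).
  have : 0 <= p + c * (1 - alpha) by rewrite addr_ge0 // mulr_ge0 // subr_ge0.
  lra.
have h2 : 2 * alpha * p / eta * Delta_p p H0 <= 2 * alpha * p / eta * Delta.
  by rewrite ler_wpM2l // divr_ge0 ?mulr_ge0 // ltW.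
lra.
Qed.
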